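(* In Ultimate Tic-Tac-Toe, let Xavier (the first player) follow an optimal winning strategy whose first move is the double $(i,i)$. If Olivia's first move is $(i,j)$ (so $j\neq i$), then Xavier's second move under this strategy must be $(j,i)$.
   Context: **Game.** Ultimate Tic-Tac-Toe is played on a board of 9 fields arranged in a $3\times3$ grid, indexed row by row from the top left: $0,1,2$ / $3,4,5$ / $6,7,8$. Each field consists of 9 spots arranged in a $3\times 3$ grid and indexed in the same way; $(i,j)$ denotes spot $j$ of field $i$. The lines of a $3\times3$ grid are its three rows, three columns and two diagonals. Xavier (marks X) moves first, then Olivia (marks O) and Xavier alternate; a move places one mark in a free spot of the active field. If the previous move was $(i,j)$ and field $j$ has a free spot, the active field is $j$ (whether or not field $j$ has already been won). If the previous move was $(i,j)$ and field $j$ has no free spot, or if there is no previous move, the player to move freely chooses as active field any field with a free spot. A player wins a field when they are the first to have three of their marks on a line of that field; once won, the status of a field never changes, though its free spots can still be played. A player wins the game when they have won three fields forming a line of the board, and the game then ends. If the board is filled with no winner the game is a draw. **Optimality.** A strategy for Xavier is winning if Xavier wins the game in every play consistent with it. The length of a winning strategy is the maximum, over all plays by Olivia, of the total number of moves (by both players) made up to and including Xavier's winning move. A winning strategy for Xavier is optimal if its length is minimal among all winning strategies for Xavier. *)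

(* Defs.v *)
From mathcomp Require Import all_boot.

Set Implicit Arguments.
Unset Strict Implicit.
Unset Printing Implicit Defensive.

Notation player := bool (only parsing).
Definition Xavier : player := true.
Definition Olivia : player := false.

(* [(i, j)] is spot [j] of field [i]. *)
Definition spot : Type := 'I_9 * 'I_9.

Local Notation line3 a b c :=
  [:: @Ordinal 9 a isT; @Ordinal 9 b isT; @Ordinal 9 c isT].

(* Serves both for the spots of a field and for the fields of the board. *)
Definition lines : seq (seq 'I_9) :=
  [:: line3 0 1 2; line3 3 4 5; line3 6 7 8;
      line3 0 3 6; line3 1 4 7; line3 2 5 8;
      line3 0 4 8; line3 2 4 6].

Definition has_line (A : pred 'I_9) : bool := has (all A) lines.

Record state := State {
  mark : spot -> option player;
  owner : 'I_9 -> option player;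
  last_move : option spot;
  to_move : player }.

Definition init : state :=
  State (fun=> None) (fun=> None) None Xavier.

(* An already owned field keeps its owner; otherwise only the player who has
   just moved can have completed a line in it. *)
Definition do_move (st : state) (m : spot) : state :=
  let p := to_move st in
  let mk x := if x == m then Some p else mark st x in
  let f := m.1 in
  let new := (owner st f == None) && has_line (fun k => mk (f, k) == Some p) in
  let own g := if new && (g == f) then Some p else owner st g in
  State mk own (Some m) (~~ p).

Definition wins (p : player) (st : state) : bool :=
  has_line (fun f => owner st f == Some p).

Definition free (st : state) (m : spot) : bool := mark st m == None.

Definition has_free_spot (st : state) (f : 'I_9) : bool :=
  [exists k : 'I_9, free st (f, k)].

Definition game_over (st : state) : bool :=
  [|| wins Xavier st, wins Olivia st | [forall f, ~~ has_free_spot st f]].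

Definition can_be_active (st : state) (f : 'I_9) : bool :=
  has_free_spot st f &&
  (if last_move st is Some (_, j) then has_free_spot st j ==> (f == j)
   else true).

Definition legal (st : state) (m : spot) : bool :=
  [&& ~~ game_over st, can_be_active st m.1 & free st m].

(* Histories list the moves in chronological order, Xavier's first. *)
Definition after (h : seq spot) : state := foldl do_move init h.

Fixpoint legal_from (st : state) (h : seq spot) : bool :=
  if h is m :: h' then legal st m && legal_from (do_move st m) h' else true.

Definition is_play (h : seq spot) : bool := legal_from init h.

Definition complete_play (h : seq spot) : bool :=
  is_play h && game_over (after h).

(* A strategy for Xavier maps the whole history to his next move. *)
Definition strategy : Type := seq spot -> spot.

Definition is_strategy (s : strategy) : Prop :=
  forall h, is_play h -> to_move (after h) = Xavier ->
    ~~ game_over (after h) -> legal (after h) (s h).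

(* Xavier makes the moves of even index, counting from 0. *)
Definition consistent (s : strategy) (h : seq spot) : bool :=
  [forall n : 'I_(size h),
     ~~ odd n ==> (tnth (in_tuple h) n == s (take n h))].

Definition winning (s : strategy) : Prop :=
  is_strategy s /\
  forall h, complete_play h -> consistent s h -> wins Xavier (after h).

(* A play has at most 81 moves (see [size_play]), so bounding [n] by 82 loses
   nothing. As the game ends as soon as a player has won it, the last move of a
   complete play won by Xavier is his winning move. *)
Definition strategy_length (s : strategy) : nat :=
  \max_(n < 82 | [exists h : n.-tuple spot,
                     complete_play h && consistent s h]) n.

Definition optimal (s : strategy) : Prop :=
  winning s /\
  forall s', winning s' -> strategy_length s <= strategy_length s'.

Lemma size_legal_from st h :
  legal_from st h -> size h <= #|[pred m | free st m]|.
Proof.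
elim: h st => [|m h IHh] st //= /andP[/and3P[_ _ fr_m] /IHh le_h].
rewrite (cardD1 m) inE fr_m add1n ltnS (leq_trans le_h) //.
apply/subset_leq_card/subsetP=> x; rewrite !inE /free /=.
by case: (x =P m).
Qed.

Lemma size_play h : is_play h -> size h <= 81.
Proof.
move=> /size_legal_from/leq_trans; apply.
by rewrite (leq_trans (max_card _)) // card_prod card_ord.
Qed.

(* Main.v *)
(* Xavier wins within 43 plies: he opens in the center and answers each
   [(center, f)] by [(f, center)], which keeps Olivia in the center field. After
   her last move [(center, c)] there he plays [(c, c)] and then keeps her in [c]
   and the opposite field [d], answering in every other field [f] by [(f, c)]
   the first time and by the winning [(f, d)] the second time. Once [d] is his, five
   of the six remaining fields always complete a line, and this happens by ply
   43 at the latest.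

   Conversely, after [(i, i)], [(i, j)], [(j, k)] with [k <> i] Olivia keeps
   Xavier in the fields [i] and [k] in the same way, so that these fields absorb
   all of his moves but [(j, k)] until they are full, after 31 or 32 plies. From
   then on she sends him to a new field each time, so by ply 43 he owns no field
   outside [i] and [k]: he cannot have won. *)
Require Import Defs.
From mathcomp Require Import all_boot zify.

Set Implicit Arguments.
Unset Strict Implicit.
Unset Printing Implicit Defensive.

(** * Lines, ownership and legal moves *)

Lemma card_has_line (P : pred 'I_9) : has_line P -> 2 < #|P|.
Proof.
have lines3 : all (fun l => uniq l && (2 < size l)) lines by [].
case/hasP=> l /(allP lines3)/andP[uniq_l size_l] /allP l_sub_P.
apply: leq_trans size_l _; rewrite -(card_uniqP uniq_l).
by apply/subset_leq_card/subsetP.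
Qed.

Lemma sub_has_line (P Q : pred 'I_9) : subpred P Q -> has_line P -> has_line Q.
Proof. by move=> subPQ; apply: sub_has => l; apply: sub_all. Qed.

Lemma wins_card p st :
  #|[pred f | owner st f == Some p]| <= 2 -> ~~ wins p st.
Proof. by rewrite leqNgt; apply: contra => /card_has_line. Qed.

Definition xcount st f := #|[pred k | mark st (f, k) == Some Xavier]|.

Lemma owner_other st m f : f != m.1 -> owner (do_move st m) f = owner st f.
Proof. by move=> /negPf f_m; rewrite /= f_m andbF. Qed.

Lemma owner_not_mover st m f p :
  p != to_move st -> owner st f != Some p -> owner (do_move st m) f != Some p.
Proof.
move=> p_st own_f /=; case: ifP => // _.
by apply: contra p_st => /eqP[->].
Qed.

(** Xavier can only come to own a field by a move that completes a line there, which takes three of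
    his marks. On Olivia's side, counting marks thus replaces any inspection of lines. *)
Lemma owner_xcount st m f :
  owner st f != Some Xavier -> xcount (do_move st m) f <= 2 ->
  owner (do_move st m) f != Some Xavier.
Proof.
have [st_X | st_O] := boolP (to_move st == Xavier); last first.
  by move=> own_f _; apply: owner_not_mover; rewrite // eq_sym.
move=> own_f; apply: contraTN => /=.
case: ifP => [/andP[/andP[_ ln] /eqP->] _ | _ /eqP own]; last first.
  by rewrite own eqxx in own_f.
rewrite -ltnNge; apply: card_has_line; by rewrite -(eqP st_X).
Qed.

Lemma legal_exists st : ~~ game_over st -> exists m, legal st m.
Proof.
rewrite /legal => not_over.
have [g g_ok] : exists f, can_be_active st f.
  have [f f_free] : exists f, has_free_spot st f.
    move: not_over; rewrite !negb_or => /and3P[_ _].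
    by rewrite negb_forall => /existsP[f]; rewrite negbK; exists f.
  rewrite /can_be_active; case: (last_move st) => [[_ k]|]; last first.
    by exists f; rewrite f_free.
  have [k_free | k_full] := boolP (has_free_spot st k).
    by exists k; rewrite k_free eqxx.
  by exists f; rewrite f_free.
have /andP[/existsP[k gk_free] _] := g_ok.
by exists (g, k); rewrite not_over g_ok.
Qed.

(** * The bounded game *)

(** Backward induction on the game tree: Xavier can win within [n] further plies, those of both
    players counted. It depends on the position only, not on histories. *)
Fixpoint force n st : bool :=
  wins Xavier st ||
  ~~ game_over st &&
  (if n is n'.+1 then
     if to_move st then [exists m, legal st m && force n' (do_move st m)]
     else [forall m, legal st m ==> force n' (do_move st m)]
   else false).

Lemma force_wins n st : wins Xavier st -> force n st.
Proof. by case: n => [|n] /= ->. Qed.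

Lemma force_game_over n st : game_over st -> force n st = wins Xavier st.
Proof. by case: n => [|n] /= ->; rewrite orbF. Qed.

Lemma force_Xavier n st m :
  to_move st = Xavier -> legal st m -> force n (do_move st m) -> force n.+1 st.
Proof.
move=> st_X m_ok force_m /=; rewrite st_X; apply/orP; right.
have /andP[-> _] := m_ok; apply/existsP; exists m; exact/andP.
Qed.

Lemma force_Olivia n st :
  to_move st = Olivia -> ~~ game_over st ->
  (forall m, legal st m -> force n (do_move st m)) -> force n.+1 st.
Proof.
move=> st_O not_over force_m /=; rewrite st_O not_over; apply/orP; right.
by apply/forallP => m; apply/implyP/force_m.
Qed.

(** The [hold] lemmas are the dual rules, for Olivia delaying a win. *)
Lemma hold0 st : ~~ wins Xavier st -> ~~ force 0 st.
Proof. by move=> /negPf /= ->; rewrite andbF. Qed.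

Lemma hold_Xavier n st :
  to_move st = Xavier -> ~~ wins Xavier st ->
  (forall m, legal st m -> ~~ force n (do_move st m)) -> ~~ force n.+1 st.
Proof.
move=> st_X /negPf not_won hold_m /=; rewrite st_X not_won /= negb_and.
apply/orP; right; apply/existsPn => m; rewrite negb_and orbC.
by case: (boolP (legal st m)) => [/hold_m->|]; rewrite // orbT.
Qed.

Lemma hold_Olivia n st :
  to_move st = Olivia -> ~~ wins Xavier st ->
  (~~ game_over st -> exists2 m, legal st m & ~~ force n (do_move st m)) ->
  ~~ force n.+1 st.
Proof.
move=> st_O /negPf not_won hold_m /=; rewrite st_O not_won /= negb_and negbK.
have [//|/hold_m[m m_ok hold]] := boolP (game_over st).
by rewrite orFb negb_forall; apply/existsP; exists m; rewrite m_ok.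
Qed.

(** * Strategies versus the bounded game *)

Lemma after_rcons h m : after (rcons h m) = do_move (after h) m.
Proof. by rewrite /after -cats1 foldl_cat. Qed.

Lemma to_move_after h : to_move (after h) = ~~ odd (size h).
Proof.
elim/last_ind: h => [//|h m IHh].
by rewrite after_rcons size_rcons /= IHh.
Qed.

Lemma is_play_rcons h m : is_play (rcons h m) = is_play h && legal (after h) m.
Proof.
rewrite /is_play /after; elim: h init => [|x h IHh] st /=; first by rewrite andbT.
by rewrite IHh andbA.
Qed.

Lemma consistent_rcons s h m :
  consistent s (rcons h m) = consistent s h && (odd (size h) || (m == s h)).
Proof.
apply/forallP/andP => [cons | [/forallP cons m_s] [n n_lt]].
  split.
    apply/forallP => -[n n_lt].
    have n_lt' : n < size (rcons h m) by rewrite size_rcons ltnW.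
    move: (cons (Ordinal n_lt')); rewrite /= !(tnth_nth m) /= nth_rcons n_lt.
    by rewrite -cats1 takel_cat // ltnW.
  have n_lt : size h < size (rcons h m) by rewrite size_rcons.
  move: (cons (Ordinal n_lt)); rewrite /= (tnth_nth m) /= nth_rcons ltnn eqxx.
  by rewrite -cats1 takel_cat // take_size implyNb.
rewrite (tnth_nth m) /= nth_rcons -cats1.
have:= n_lt; rewrite size_rcons ltnS leq_eqVlt => /predU1P[-> | n_lt'].
  by rewrite ltnn eqxx takel_cat // take_size implyNb.
rewrite n_lt' takel_cat; last exact: ltnW.
by have:= cons (Ordinal n_lt'); rewrite (tnth_nth m).
Qed.

Lemma size_le_strategy_length s h :
  complete_play h -> consistent s h -> size h <= strategy_length s.
Proof.
move=> h_play h_cons.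
have h_lt : size h < 82.
  by have /andP[/size_play] := h_play.
apply: (@leq_bigmax_cond _ _ (fun n : 'I_82 => n : nat) (Ordinal h_lt)).
by apply/existsP; exists (in_tuple h); rewrite /= h_play.
Qed.

(** The consistent plays extending [h] form a subtree that witnesses [force]. The induction on
    [82 - size h] is founded on the bound of 81 moves. *)
Lemma force_consistent s n h :
  winning s -> strategy_length s <= n -> is_play h -> consistent s h ->
  force (n - size h) (after h).
Proof.
move=> [s_strat s_wins] s_len; have [d] := ubnP (82 - size h).
elim: d h => [//|d IHd] h h_d h_play h_cons.
have [h_over | h_not_over] := boolP (game_over (after h)).
  by rewrite force_game_over // s_wins // /complete_play h_play.
have step m : legal (after h) m -> consistent s (rcons h m) ->
    size h < n /\ force (n - (size h).+1) (do_move (after h) m).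
  move=> m_ok m_cons.
  have m_play : is_play (rcons h m) by rewrite is_play_rcons h_play.
  have m_force : force (n - (size h).+1) (do_move (after h) m).
    rewrite -after_rcons -(size_rcons h m); apply: IHd => //.
    by have := size_play m_play; rewrite size_rcons; lia.
  (* Truncated subtraction could hide an exhausted budget: if [n <= size h], the child satisfies
     [force 0], so it is a won play of more than [n] moves, against [s_len]. *)
  split=> //; rewrite ltnNge; apply/negP => n_le.
  have over : complete_play (rcons h m).
    rewrite /complete_play m_play after_rcons /game_over.
    move: m_force; have -> : n - (size h).+1 = 0 by lia.
    by rewrite /= andbF orbF => ->.
  have := leq_trans (size_le_strategy_length over m_cons) s_len.
  by rewrite size_rcons; lia.
have succE : size h < n -> n - size h = (n - (size h).+1).+1 by lia.
have [h_odd | h_even] := boolP (odd (size h)).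
  have step' m : legal (after h) m ->
      size h < n /\ force (n - (size h).+1) (do_move (after h) m).
    by move=> m_ok; apply: step; rewrite // consistent_rcons h_cons h_odd.
  have [m /step'[/succE-> _]] := legal_exists h_not_over.
  apply: force_Olivia => // [|m' /step'[] //].
  by rewrite to_move_after h_odd.
have h_X : to_move (after h) = Xavier by rewrite to_move_after h_even.
have s_ok := s_strat _ h_play h_X h_not_over.
have [|/succE-> s_force] := step _ s_ok.
  by rewrite consistent_rcons h_cons eqxx orbT.
exact: force_Xavier s_force.
Qed.

(** Xavier always picks a move that preserves [force] for the remaining budget. *)
Lemma force_strategy n :
  force n init -> exists2 s, winning s & strategy_length s <= n.
Proof.
move=> force_init.
pose good h m := legal (after h) m && force (n - (size h).+1) (do_move (after h) m).
(* The fallback to any legal move makes [s] a strategy on all histories, even those it never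
   produces; [(ord0, ord0)] serves only where no move is legal. *)
pose s h := if [pick m | good h m] is Some m then m
            else odflt (ord0, ord0) [pick m | legal (after h) m].
have s_strat : is_strategy s.
  move=> h _ _ /legal_exists[m m_ok]; rewrite /s.
  case: pickP => [m' /andP[] // | _].
  by case: pickP => [// | /(_ m)]; rewrite m_ok.
have s_force h : is_play h -> consistent s h ->
    force (n - size h) (after h) && (size h <= n).
  elim/last_ind: h => [|h m IHh]; first by rewrite subn0 force_init.
  rewrite is_play_rcons consistent_rcons => /andP[h_play m_ok] /andP[h_cons m_s].
  have /andP[h_force h_n] := IHh h_play h_cons.
  have /andP[not_over _] := m_ok.
  have not_won : wins Xavier (after h) = false.
    by apply/negbTE; apply: contra not_over; rewrite /game_over => ->.
  move: h_force; rewrite after_rcons size_rcons.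
  (* With the budget spent, [force] would mean a won position, where [m] is not legal. *)
  have [n_le | n_gt] := leqP n (size h).
    have -> : n - size h = 0 by lia.
    by rewrite /= not_won andbF.
  rewrite andbT (_ : n - size h = (n - (size h).+1).+1) /=; last by lia.
  rewrite not_won not_over to_move_after /=.
  case: ifP => [/negPf h_even /existsP[m' good_m'] | /negbFE h_odd].
    move: m_s; rewrite h_even /s => /eqP ->.
    by case: pickP => [m'' /andP[] // | /(_ m')]; rewrite /good good_m'.
  by move/forallP/(_ m)/implyP; apply.
exists s.
  split=> // h /andP[h_play h_over] h_cons.
  by have /andP[] := s_force _ h_play h_cons; rewrite force_game_over.
apply/bigmax_leqP => k /existsP[h /andP[/andP[h_play _] h_cons]].
by have /andP[_] := s_force _ h_play h_cons; rewrite size_tuple.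
Qed.

(** * Effect of a move on marks and active fields *)

Lemma free_do_move st m x : free (do_move st m) x = (x != m) && free st x.
Proof. by rewrite /free /=; case: (eqVneq x m). Qed.

Lemma legal_active st m f k x :
  last_move st = Some (m, f) -> free st (f, k) -> legal st x ->
  x.1 = f /\ free st x.
Proof.
move=> st_last fk_free /and3P[_ /andP[_]]; rewrite st_last => /implyP x_f ->.
by split=> //; apply/eqP/x_f/existsP; exists k.
Qed.

Lemma legal_reply st m f k :
  last_move st = Some (m, f) -> ~~ game_over st -> free st (f, k) ->
  legal st (f, k).
Proof.
move=> st_last not_over fk_free; rewrite /legal not_over fk_free andbT /=.
rewrite /can_be_active st_last eqxx implybT andbT.
by apply/existsP; exists k.
Qed.

Lemma legal_anywhere st m f x :
  last_move st = Some (m, f) -> (forall k, ~~ free st (f, k)) ->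
  ~~ game_over st -> free st x -> legal st x.
Proof.
move=> st_last f_full not_over x_free; rewrite /legal not_over x_free andbT /=.
rewrite /can_be_active st_last; apply/andP; split.
  by apply/existsP; exists x.2; rewrite -surjective_pairing.
by apply/implyP => /existsP[k]; rewrite (negPf (f_full k)).
Qed.

Lemma xcount_do_move st m f :
  xcount (do_move st m) f <= (to_move st && (f == m.1)) + xcount st f.
Proof.
have [/andP[st_X /eqP ->] | not_X] := boolP (to_move st && (f == m.1)).
  apply: leq_trans
    (_ : #|[predU1 m.2 & [pred k | mark st (m.1, k) == Some Xavier]]| <= _).
    apply/subset_leq_card/subsetP => k; rewrite !inE /=.
    by case: m => m1 m2; rewrite xpair_eqE eqxx /=; case: (k == m2).
  by rewrite cardU1 leq_add2r; case: (_ \notin _).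
apply/subset_leq_card/subsetP => k; rewrite !inE /=.
case: m not_X => m1 m2; rewrite xpair_eqE /=.
case: (f == m1) => //=; rewrite andbT => /negPf ->.
by case: (k == m2).
Qed.

(** * Olivia's endgame: fresh fields *)

(* Both fields of [T] are filled. The fields of [Z] are fresh: Xavier has not
   moved in them, and Olivia has never sent him there from outside [T]. *)
Record endgame (T Z : {set 'I_9}) st := Endgame {
  endgame_full : forall (f : 'I_9) k, f \in T -> ~~ free st (f, k);
  endgame_owner : forall f : 'I_9, f \notin T -> owner st f != Some Xavier;
  endgame_fresh : forall f : 'I_9, f \in Z -> f \notin T;
  endgame_X : forall (f : 'I_9) k, f \in Z -> mark st (f, k) != Some Xavier;
  endgame_O : forall f g : 'I_9, f \notin T -> g \in Z -> mark st (f, g) != Some Olivia;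
  endgame_inj : forall f g g' : 'I_9, f \notin T -> g \notin T -> g' \notin T ->
    mark st (f, g) = Some Xavier -> mark st (f, g') = Some Xavier -> g = g' }.

Lemma not_wins_out (T : {set 'I_9}) p st :
  #|T| <= 2 -> (forall f, f \notin T -> owner st f != Some p) -> ~~ wins p st.
Proof.
move=> T_le2 own; apply: wins_card; apply: leq_trans T_le2.
apply/subset_leq_card/subsetP => f; rewrite inE.
by apply: contraLR => /own.
Qed.

(** Olivia has used neither of two fresh indices in [f], and Xavier has at most one mark there with
    index outside [T], so one of the two spots is free. *)
Lemma endgame_free T Z st f :
  endgame T Z st -> 1 < #|Z| -> f \notin T -> exists2 g, g \in Z & free st (f, g).
Proof.
move=> st_end /card_gt1P[g [g' [Zg Zg' neq_g]]] Tf.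
have [g_free | g_used] := boolP (free st (f, g)); first by exists g.
have [g'_free | g'_used] := boolP (free st (f, g')); first by exists g'.
have usedX h : h \in Z -> ~~ free st (f, h) -> mark st (f, h) = Some Xavier.
  move=> /(endgame_O st_end Tf); rewrite /free.
  by case: (mark _ _) => [[]|].
case/eqP: neq_g; apply: (endgame_inj st_end Tf).
- exact: (endgame_fresh st_end Zg).
- exact: (endgame_fresh st_end Zg').
- exact: usedX.
exact: usedX.
Qed.

(** Xavier's reply is his first mark in [g]: too few to own it, and unable to violate
    [endgame_inj]. *)
Lemma endgame_step T Z st f g k :
  endgame T Z st -> to_move st = Olivia -> f \notin T -> g \in Z ->
  endgame T (Z :\ g) (do_move (do_move st (f, g)) (g, k)).
Proof.
move=> st_end st_O Tf Zg; have Tg := endgame_fresh st_end Zg.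
have g0 : xcount st g = 0.
  by apply/eq_card0 => h; rewrite inE (negPf (endgame_X st_end h Zg)).
split.
- move=> f' k' Tf'; rewrite !free_do_move (negPf (endgame_full st_end k' Tf')).
  by rewrite !andbF.
- move=> f' Tf'.
  have own : owner (do_move st (f, g)) f' != Some Xavier.
    by apply: owner_not_mover (endgame_owner st_end Tf'); rewrite st_O.
  have [eq_g | neq_g] := eqVneq f' g; last by rewrite owner_other.
  apply: owner_xcount => //; rewrite eq_g.
  apply: leq_trans (xcount_do_move _ _ _) _.
  have := xcount_do_move st (f, g) g; rewrite st_O g0 /= eqxx.
  by lia.
- by move=> f' /setD1P[_ /(endgame_fresh st_end)].
- move=> f' k' /setD1P[neq_g Zf'] /=; rewrite xpair_eqE (negPf neq_g) /=.
  by rewrite st_O; case: ifP => // _; apply: (endgame_X st_end).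
- move=> f' g' Tf' /setD1P[neq_g Zg'] /=; rewrite st_O.
  case: ifP => // _; rewrite xpair_eqE (negPf neq_g) andbF.
  exact: (endgame_O st_end).
move=> f' h h' Tf' Th Th' /=; rewrite st_O /= !xpair_eqE.
have [-> | _] := eqVneq f' g; last first.
  by do 2 case: ifP => //= _; apply: (endgame_inj st_end).
have noX x : (if (g == f) && (x == g) then Some Olivia
    else mark st (g, x)) <> Some Xavier.
  by case: ifP => // _; apply/eqP/(endgame_X st_end).
rewrite /=; case: (h =P k) => [-> _ | _ /noX //].
by case: (h' =P k) => [-> // | _ /noX].
Qed.

(* In each of his next [r] moves Xavier is sent to a fresh field. *)
Lemma endgame_hold (T : {set 'I_9}) r : forall Z st m,
  #|T| <= 2 -> endgame T Z st -> to_move st = Olivia -> last_move st = Some m ->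
  (forall f, f \notin T -> xcount st f <= 1) /\ r <= #|Z| \/
  (forall f, f \notin T -> xcount st f <= 2) /\ r < #|Z| ->
  ~~ force r.*2 st.
Proof.
elim: r => [|r IHr] Z st [m0 m] T_le2 st_end st_O st_last st_count.
all: have not_won := not_wins_out T_le2 (endgame_owner st_end).
  exact: hold0.
rewrite doubleS; apply: hold_Olivia => // not_over.
(* With at most one fresh field, [st_count] leaves a single round and at most one mark of Xavier per
   field outside [T]. Whatever Olivia plays, his last move makes at most two. *)
have [Z_gt1 | Z_le1] := ltnP 1 #|Z|; last first.
  have [x x_ok] := legal_exists not_over; exists x => //.
  have own : forall f, f \notin T -> owner (do_move st x) f != Some Xavier.
    move=> f Tf; apply: owner_not_mover (endgame_owner st_end Tf).
    by rewrite st_O.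
  have [count1 r0] : (forall f, f \notin T -> xcount st f <= 1) /\ r = 0.
    by case: st_count => -[? ?]; split=> //; lia.
  apply: hold_Xavier; first by rewrite /= st_O.
    exact: not_wins_out own.
  move=> y _; rewrite r0; apply/hold0/(not_wins_out T_le2) => f Tf.
  apply: owner_xcount (own f Tf) _.
  apply: leq_trans (xcount_do_move _ _ _) _.
  have := xcount_do_move st x f; rewrite st_O /=; have := count1 f Tf.
  by case: (_ == _); lia.
(* Sent outside [T], Olivia plays in that field; sent into [T], which is full, she chooses a fresh
   field. *)
have [f [Tf f_reply]] : exists f, f \notin T /\
    forall g, free st (f, g) -> legal st (f, g).
  have [Tm | Tm] := boolP (m \in T); last first.
    by exists m; split=> // g; apply: legal_reply st_last _.
  have /card_gt0P[f Zf] : 0 < #|Z| by lia.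
  exists f; split=> [|g]; first exact: (endgame_fresh st_end Zf).
  by apply: legal_anywhere st_last _ _ => // k; apply: (endgame_full st_end).
have [g Zg fg_free] := endgame_free st_end Z_gt1 Tf.
exists (f, g); first exact: f_reply.
apply: hold_Xavier; first by rewrite /= st_O.
  apply: not_wins_out T_le2 _ => f' Tf'; apply: owner_not_mover.
    by rewrite st_O.
  exact: (endgame_owner st_end).
(* A second fresh index [g'] provides a free spot in [g], so Xavier has to move there. *)
have /card_gt0P[g' /setD1P[neq_g Zg']] : 0 < #|Z :\ g|.
  by have := cardsD1 g Z; rewrite Zg; lia.
have Tg := endgame_fresh st_end Zg.
have gg'_free : free (do_move st (f, g)) (g, g').
  rewrite free_do_move xpair_eqE (negPf neq_g) andbF /=.
  have := endgame_O st_end Tg Zg'; have := endgame_X st_end g' Zg.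
  by rewrite /free; case: (mark _ _) => [[]|].
have st1_last : last_move (do_move st (f, g)) = Some (f, g) by [].
move=> [h k] /(legal_active st1_last gg'_free)[/= -> _].
have card_Z := cardsD1 g Z; rewrite Zg in card_Z.
have step_end := endgame_step k st_end st_O Tf Zg.
apply: IHr T_le2 step_end _ erefl _; first by rewrite /= st_O.
have count f' : xcount (do_move (do_move st (f, g)) (g, k)) f' <= (f' == g) + xcount st f'.
  apply: leq_trans (xcount_do_move _ _ _) _; rewrite /= st_O /=.
  by rewrite leq_add2l; have := xcount_do_move st (f, g) f'; rewrite st_O.
have g0 : xcount st g = 0.
  by apply/eq_card0 => h'; rewrite inE (negPf (endgame_X st_end h' Zg)).
have count' c : 0 < c -> (forall f', f' \notin T -> xcount st f' <= c) ->
    forall f', f' \notin T -> xcount (do_move (do_move st (f, g)) (g, k)) f' <= c.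
  move=> c_gt0 st_le f' Tf'; apply: leq_trans (count f') _.
  by have [-> | _] := eqVneq f' g; [rewrite g0 | apply: st_le].
rewrite add1n in card_Z.
case: st_count => -[st_le]; rewrite card_Z => r_le; [left|right]; split=> //.
  exact: count'.
exact: count'.
Qed.

(** * From the confinement of Xavier to the endgame *)

Definition filled (T : {set 'I_9}) st :=
  forall (f : 'I_9) g, f \in T -> ~~ free st (f, g).

(** What the endgame has to know about the fields outside [T] while play goes on inside; [(j, k)]
    will be Xavier's second move. *)
Record quiet (T : {set 'I_9}) j k st := Quiet {
  quiet_owner : forall f : 'I_9, f \notin T -> owner st f != Some Xavier;
  quiet_free : forall f g : 'I_9, f \notin T -> g \notin T -> free st (f, g);
  quiet_X : forall (f : 'I_9) g, f \notin T -> mark st (f, g) = Some Xavier ->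
    f = j /\ g = k }.

Lemma quiet_xcount (T : {set 'I_9}) j k st f :
  quiet T j k st -> f \notin T -> xcount st f <= (f == j).
Proof.
move=> st_quiet Tf; have [eq_j | neq_j] := eqVneq f j; last first.
  rewrite leqn0; apply/eqP/eq_card0 => g; rewrite inE.
  by apply/eqP => /(quiet_X st_quiet Tf)[eq_j]; rewrite eq_j eqxx in neq_j.
rewrite /= -[X in _ <= X](card1 k); apply/subset_leq_card/subsetP => g.
rewrite !inE; by move=> /eqP/(quiet_X st_quiet Tf)[_ ->].
Qed.

(** Only [j] may fail to be fresh. As [k] is in [T], the mark [(j, k)] does not count for
    [endgame_inj]. *)
Lemma quiet_endgame (T : {set 'I_9}) j k st :
  k \in T -> quiet T j k st -> filled T st -> endgame T (~: T :\ j) st.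
Proof.
move=> Tk st_quiet st_full; split.
- exact: st_full.
- exact: (quiet_owner st_quiet).
- by move=> f; rewrite !inE => /andP[].
- move=> f g; rewrite !inE => /andP[neq_j Tf].
  by apply/eqP => /(quiet_X st_quiet Tf)[eq_j]; rewrite eq_j eqxx in neq_j.
- move=> f g Tf; rewrite !inE => /andP[_ Tg].
  by rewrite (eqP (quiet_free st_quiet Tf Tg)).
- move=> f g g' Tf Tg _ /(quiet_X st_quiet Tf)[_ eq_k].
  by rewrite eq_k Tk in Tg.
Qed.

(** If [T] is full with Xavier to move, his free move costs at most one more fresh field. *)
Lemma quiet_endgame_Xavier (T : {set 'I_9}) j k st m :
  k \in T -> quiet T j k st -> filled T st -> m.1 \notin T -> to_move st = Xavier ->
  endgame T (~: T :\ j :\ m.1) (do_move st m).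
Proof.
move=> Tk st_quiet st_full Tm st_X; have st_end := quiet_endgame Tk st_quiet st_full.
split.
- move=> f g Tf; rewrite free_do_move negb_and.
  by rewrite st_full // orbT.
- move=> f Tf; apply: owner_xcount (quiet_owner st_quiet Tf) _.
  apply: leq_trans (xcount_do_move _ _ _) _; have := quiet_xcount st_quiet Tf.
  by case: (_ && _); case: (f == j) => /= ?; lia.
- by move=> f; rewrite !inE => /and3P[].
- move=> f g /setD1P[neq_m Zf]; rewrite /= ifN ?(endgame_X st_end) //.
  by case: m neq_m {Tm} => m1 m2 /= neq_m; rewrite xpair_eqE (negPf neq_m).
- move=> f g Tf /setD1P[_ Zg]; rewrite /= st_X.
  by case: ifP => // _; apply: (endgame_O st_end).
move=> f g g' Tf Tg Tg'; rewrite /= st_X.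
have noX x : x \notin T -> mark st (f, x) <> Some Xavier.
  by move=> Tx; rewrite (eqP (quiet_free st_quiet Tf Tx)).
case: eqP => [<- | _ /noX] // _; case: eqP => [|_ /noX] //.
by case=> ->.
Qed.

Lemma quiet_do_move (T : {set 'I_9}) j k st m :
  quiet T j k st -> m.1 \in T -> quiet T j k (do_move st m).
Proof.
case: m => m1 m2 st_quiet /= Tm.
have neq_m f : f \notin T -> (f == m1) = false.
  by move=> Tf; apply/negbTE; apply: contraNneq Tf => ->.
split=> [f Tf | f g Tf Tg | f g Tf].
- by rewrite owner_other ?(quiet_owner st_quiet) //= neq_m.
- by rewrite free_do_move xpair_eqE neq_m //= (quiet_free st_quiet).
by rewrite /= xpair_eqE neq_m //; apply: (quiet_X st_quiet).
Qed.

(** * The trap formed by two fields *)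

(* Xavier is confined to the fields [i] and [k]; [A] and [B] are the sets of
   fields outside [[set i; k]] indexed by the spots taken in [i] and in [k].
   Olivia answers in a field [f] outside [[set i; k]] by [(f, k)] on her first
   visit and by [(f, i)] on her second one; [b] tells whether [(i, k)] and
   [(k, i)] are taken. *)
Definition trap_used (i k : 'I_9) (A B : {set 'I_9}) (b : bool) (x : spot) :=
  if x.1 == i then [|| x.2 == i, x.2 \in A | (x.2 == k) && b]
  else if x.1 == k then [|| x.2 == k, x.2 \in B | (x.2 == i) && b]
  else (x.2 == k) && (x.1 \in A :|: B) || (x.2 == i) && (x.1 \in A :&: B).

Record trap (i k j : 'I_9) (A B : {set 'I_9}) (b : bool) st := Trap {
  trap_sub : A :|: B \subset ~: [set i; k];
  trap_free : forall x, free st x = ~~ trap_used i k A B b x;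
  trap_owner : forall f, f \notin [set i; k] -> owner st f != Some Xavier;
  trap_X : forall f g, f \notin [set i; k] -> mark st (f, g) = Some Xavier ->
    f = j /\ g = k }.

(** The four rounds through an outside field [f]: first visit from [k], first from [i], second from
    [k], second from [i]. *)
Lemma trap_used_round (i k f : 'I_9) (A B : {set 'I_9}) b x :
  i != k -> f \notin [set i; k] ->
  [/\ f \notin A -> f \notin B -> trap_used i k A (f |: B) b x =
        [|| x == (f, k), x == (k, f) | trap_used i k A B b x],
      f \notin A -> f \notin B -> trap_used i k (f |: A) B b x =
        [|| x == (f, k), x == (i, f) | trap_used i k A B b x],
      f \in A -> f \notin B -> trap_used i k A (f |: B) b x =
        [|| x == (f, i), x == (k, f) | trap_used i k A B b x] &
      f \notin A -> f \in B -> trap_used i k (f |: A) B b x =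
        [|| x == (f, i), x == (i, f) | trap_used i k A B b x]].
Proof.
move=> neq_ik; rewrite !inE negb_or => /andP[neq_fi neq_fk].
have neqs := (negPf neq_ik, negPf neq_fi, negPf neq_fk).
have neqs' : ((k == i) = false) * ((i == f) = false) * ((k == f) = false).
  by rewrite (eq_sym k i) (eq_sym i f) (eq_sym k f) !neqs.
case: x => u v; split=> fA fB; rewrite /trap_used !inE !xpair_eqE /=;
  (have [->|_] := eqVneq u i;
    first by rewrite ?neqs ?neqs' ?eqxx /=;
      do ?case: (_ == _); do ?case: (_ \in _); case: (b));
  (have [->|_] := eqVneq u k;
    first by rewrite ?neqs ?neqs' ?eqxx /=;
      do ?case: (_ == _); do ?case: (_ \in _); case: (b));
  have [->|_] := eqVneq u f;
    rewrite ?neqs ?neqs' ?fA ?fB ?(negPf fA) ?(negPf fB) ?eqxx /=;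
  by do ?case: (_ == _); do ?case: (_ \in _); case: (b).
Qed.

(** The remaining kind of round: each player takes one of [(i, k)] and [(k, i)]. *)
Lemma trap_used_swap (i k : 'I_9) (A B : {set 'I_9}) x :
  i != k ->
  trap_used i k A B true x = [|| x == (i, k), x == (k, i) | trap_used i k A B false x].
Proof.
move=> neq_ik; case: x => u v; rewrite /trap_used !xpair_eqE /= !andbT !andbF !orbF.
have [->|_] := eqVneq u i.
  by rewrite (negPf neq_ik); do !case: (_ == _); do ?case: (_ \in _).
by do !case: (_ == _); do ?case: (_ \in _).
Qed.

Lemma trap_quiet (i k j : 'I_9) A B b st :
  trap i k j A B b st -> quiet [set i; k] j k st.
Proof.
move=> st_trap; split=> [f Tf | f g | f g Tf].
- exact: (trap_owner st_trap).
- rewrite !inE !negb_or => /andP[/negPf fi /negPf fk] /andP[/negPf gi /negPf gk].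
  by rewrite (trap_free st_trap) /trap_used /= fi fk gi gk.
exact: (trap_X st_trap).
Qed.

Lemma trap_round (i k j : 'I_9) A B b A' B' b' st m1 m2 :
  trap i k j A B b st -> to_move st = Xavier -> m1.1 \in [set i; k] ->
  A' :|: B' \subset ~: [set i; k] ->
  (forall x, trap_used i k A' B' b' x =
     [|| x == m2, x == m1 | trap_used i k A B b x]) ->
  trap i k j A' B' b' (do_move (do_move st m1) m2).
Proof.
move=> st_trap st_X Tm1 sub used; have st1_quiet := quiet_do_move (trap_quiet st_trap) Tm1.
split=> // [x | f Tf | f g Tf].
- by rewrite !free_do_move (trap_free st_trap) used !negb_or.
- by apply: owner_not_mover (quiet_owner st1_quiet Tf); rewrite /= st_X.
have : to_move (do_move st m1) = Olivia by rewrite /= st_X.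
move: (do_move st m1) st1_quiet => st1 st1_quiet st1_O /=.
by rewrite st1_O; case: ifP => // _; apply: (quiet_X st1_quiet).
Qed.

Lemma ex_setD (A C : {set 'I_9}) : #|A| < #|C| -> exists2 f, f \in C & f \notin A.
Proof.
move=> lt_AC; apply/subsetPn; apply: contraL lt_AC => /subset_leq_card.
by rewrite -leqNgt.
Qed.

Lemma cardsC2 (i k : 'I_9) : i != k -> #|~: [set i; k]| = 7.
Proof. by move=> neq_ik; have := cardsC [set i; k]; rewrite cards2 neq_ik card_ord; lia. Qed.

Lemma leq_cardsD1 (Z : {set 'I_9}) x : #|Z| <= #|Z :\ x|.+1.
Proof. by rewrite (cardsD1 x Z); case: (x \in Z); rewrite ?add1n // add0n leqnSn. Qed.

(** Six rounds remain, and at least six of the seven outside fields are fresh. *)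
Lemma trap_endgame (i k j : 'I_9) st m :
  i != k -> quiet [set i; k] j k st -> filled [set i; k] st ->
  to_move st = Olivia -> last_move st = Some m -> ~~ force 12 st.
Proof.
move=> neq_ik st_quiet st_full st_O st_last.
have Tk : k \in [set i; k] by rewrite !inE eqxx orbT.
have card_T : #|[set i; k]| <= 2 by rewrite cards2; case: (i != k).
apply: (@endgame_hold _ 6 _ _ _ card_T (quiet_endgame Tk st_quiet st_full) st_O st_last).
left; split=> [f Tf|].
  by apply: leq_trans (quiet_xcount st_quiet Tf) _; case: (f == j).
by rewrite -ltnS; apply: leq_trans (leq_cardsD1 _ _); rewrite cardsC2.
Qed.

(** Xavier's free move leaves five rounds. In [j] it may make a second mark but costs no fresh
    field; elsewhere it costs one but no field has two marks. Hence the two alternatives in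
    [endgame_hold]. *)
Lemma trap_endgame_Xavier (i k j : 'I_9) st :
  i != k -> quiet [set i; k] j k st -> filled [set i; k] st ->
  to_move st = Xavier -> ~~ force 11 st.
Proof.
move=> neq_ik st_quiet st_full st_X.
have Tk : k \in [set i; k] by rewrite !inE eqxx orbT.
have card_T : #|[set i; k]| <= 2 by rewrite cards2; case: (i != k).
apply: hold_Xavier => // [|[f g] /and3P[_ _ fg_free]].
  by apply: not_wins_out card_T _ => f; apply: (quiet_owner st_quiet).
have Tf : f \notin [set i; k] by apply: contraL fg_free; apply: st_full.
have st_end := quiet_endgame_Xavier (m := (f, g)) Tk st_quiet st_full Tf st_X.
apply: (@endgame_hold _ 5 _ _ _ card_T st_end) => //; first by rewrite /= st_X.
have count f' : f' \notin [set i; k] ->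
    xcount (do_move st (f, g)) f' <= (f' == f) + (f' == j).
  move=> Tf'; apply: leq_trans (xcount_do_move _ _ _) _; rewrite st_X leq_add2l.
  exact: quiet_xcount st_quiet Tf'.
have Zj : 6 <= #|~: [set i; k] :\ j|.
  by rewrite -ltnS; apply: leq_trans (leq_cardsD1 _ _); rewrite cardsC2.
have [eq_fj | neq_fj] := eqVneq f j; [right | left]; split.
- by move=> f' Tf'; apply: leq_trans (count f' Tf') _; do !case: (_ == _).
- by move: Zj; rewrite eq_fj (cardsD1 j) !inE eqxx.
- move=> f' Tf'; apply: leq_trans (count f' Tf') _.
  have [->|_] := eqVneq f' f; first by rewrite (negPf neq_fj).
  by case: (_ == _).
by rewrite -ltnS; apply: leq_trans (leq_cardsD1 _ _).
Qed.

(* The constant 41 leaves 12 plies once [i] and [k] are full and Olivia is to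
   move. *)
Lemma trap_hold (i k j : 'I_9) n : forall A B b st m a,
  i != k -> trap i k j A B b st -> to_move st = Xavier ->
  last_move st = Some (m, a) -> a \in [set i; k] ->
  #|A :|: B| = (a == k) + #|B| -> (a == i -> ~~ ((A == ~: [set i; k]) && b)) ->
  n + (#|A| + #|B| + b).*2 = 41 -> ~~ force n st.
Proof.
(* The invariant [card_AB] says that [A] is contained in [B] when Xavier is sent to [i], and has
   exactly one element outside [B] when he is sent to [k]. *)
elim/ltn_ind: n => n IHn A B b st m a neq_ik st_trap st_X st_last Ta card_AB a_open n_eq.
have card_T : #|[set i; k]| <= 2 by rewrite cards2; case: (i != k).
have card_TC := cardsC2 neq_ik.
have neq_ki : (k == i) = false by rewrite eq_sym (negPf neq_ik).
have /subUsetP[sub_A sub_B] := trap_sub st_trap.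
have le_A := subset_leq_card sub_A; have le_B := subset_leq_card sub_B.
have le_AB := subset_leq_card (trap_sub st_trap).
rewrite card_TC in le_A le_B le_AB.
have out f (C : {set 'I_9}) : C \subset ~: [set i; k] -> f \in C -> f \notin [set i; k].
  by move=> /subsetP sub_C /sub_C; rewrite inE.
have notA f : f \in [set i; k] -> f \in A = false.
  by move=> Tf; apply/negbTE; apply: contraL Tf; apply: out.
have notB f : f \in [set i; k] -> f \in B = false.
  by move=> Tf; apply/negbTE; apply: contraL Tf; apply: out.
have Ti : i \in [set i; k] by rewrite !inE eqxx.
have Tk : k \in [set i; k] by rewrite !inE eqxx orbT.
have free_i g : free st (i, g) = ~~ [|| g == i, g \in A | (g == k) && b].
  by rewrite (trap_free st_trap) /trap_used /= eqxx.
have free_k g : free st (k, g) = ~~ [|| g == k, g \in B | (g == i) && b].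
  by rewrite (trap_free st_trap) /trap_used /= neq_ki eqxx.
have free_o f g : f \notin [set i; k] -> free st (f, g) =
    ~~ ((g == k) && (f \in A :|: B) || (g == i) && (f \in A :&: B)).
  rewrite !inE negb_or => /andP[/negPf fi /negPf fk].
  by rewrite (trap_free st_trap) /trap_used /= fi fk !inE.
have {free_o} [free_ok free_oi] :
    (forall f, f \notin [set i; k] -> free st (f, k) = (f \notin A :|: B)) /\
    (forall f, f \notin [set i; k] -> free st (f, i) = (f \notin A :&: B)).
  by split=> f /free_o ->; rewrite ?(negPf neq_ik) ?neq_ki eqxx ?orbF.
(* In [i] this is [a_open]; in [k], [card_AB] leaves at most six of seven elements in [B]. *)
have [x ax_free] : exists x, free st (a, x).
  move: a_open Ta card_AB; have [-> a_open _ _ | neq_ai _] := eqVneq a i.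
    move: (a_open isT); case b_val: b; last first.
      by exists k; rewrite free_i neq_ki notA // b_val andbF.
    rewrite andbT => A_neq; have [f Tf Af] : exists2 f, f \in ~: [set i; k] & f \notin A.
      by apply: ex_setD; apply: proper_card; rewrite properEneq A_neq.
    exists f; move: Tf; rewrite free_i (negPf Af) !inE negb_or.
    by move=> /andP[/negPf -> /negPf ->].
  rewrite !inE (negPf neq_ai) /= => /eqP ->; rewrite eqxx => card_AB.
  have [|f Tf Bf] := @ex_setD B (~: [set i; k]).
    by rewrite card_TC; move: card_AB le_AB => ->.
  exists f; move: Tf; rewrite free_k (negPf Bf) !inE negb_or.
  by move=> /andP[/negPf -> /negPf ->].
(* At most 7 + 7 + 1 units are used up, and 41 - 30 = 11. *)
have n_gt : 10 < n.
  by move: n_eq le_A le_B; clear; move: #|A| #|B| => cA cB; case: b => /=; lia.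
have -> : n = n.-2.+2 by move: n_gt; clear; lia.
apply: hold_Xavier => // [|[a' y] /(legal_active st_last ax_free)[eq_a ay_free]].
  by apply: not_wins_out card_T _ => f; apply: (trap_owner st_trap).
rewrite [fst _]/= in eq_a; subst a'.
clear x ax_free; rename y into x, ay_free into ax_free.
have st1_quiet : quiet [set i; k] j k (do_move st (a, x)).
  exact: quiet_do_move (trap_quiet st_trap) _.
have st1_O : to_move (do_move st (a, x)) = Olivia by rewrite /= st_X.
have st1_last : last_move (do_move st (a, x)) = Some (a, x) by [].
have reply z A' B' b' : free st (x, z) -> (x, z) != (a, x) ->
    (~~ game_over (do_move st (a, x)) -> legal (do_move st (a, x)) (x, z) ->
       trap i k j A' B' b' (do_move (do_move st (a, x)) (x, z)) ->
       ~~ force n.-2 (do_move (do_move st (a, x)) (x, z))) ->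
    A' :|: B' \subset ~: [set i; k] ->
    (forall p, trap_used i k A' B' b' p =
       [|| p == (x, z), p == (a, x) | trap_used i k A B b p]) ->
    ~~ force n.-2.+1 (do_move st (a, x)).
  move=> xz_free neq_xz hold sub used; apply: hold_Olivia => // [|not_over].
    by apply: not_wins_out card_T _ => f; apply: (quiet_owner st1_quiet).
  have xz_legal : legal (do_move st (a, x)) (x, z).
    by apply: legal_reply st1_last not_over _; rewrite free_do_move neq_xz.
  by exists (x, z) => //; apply: hold => //; apply: (trap_round st_trap st_X _ sub used).
have next z A' B' b' : free st (x, z) -> (x, z) != (a, x) ->
    A' :|: B' \subset ~: [set i; k] ->
    (forall p, trap_used i k A' B' b' p =
       [|| p == (x, z), p == (a, x) | trap_used i k A B b p]) ->
    z \in [set i; k] -> #|A' :|: B'| = (z == k) + #|B'| ->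
    (z == i -> ~~ ((A' == ~: [set i; k]) && b')) ->
    #|A'| + #|B'| + b' = (#|A| + #|B| + b).+1 ->
    ~~ force n.-2.+1 (do_move st (a, x)).
  move=> xz_free neq_xz sub used Tz card' z_open n'_eq.
  apply: reply xz_free neq_xz _ sub used => _ _ st2_trap.
  apply: (IHn n.-2 _ _ _ _ _ _ _ neq_ik st2_trap _ erefl Tz card' z_open).
  - by move: n_gt; clear; lia.
  - by rewrite /= st_X.
  by move: n_gt n_eq; rewrite n'_eq; clear; move: (_ + b) => c; lia.
(* Here Xavier's own move fills the trap: 41 - 28 - 1 = 12 plies remain, Olivia to move. *)
have finish : filled [set i; k] (do_move st (a, x)) -> #|A| + #|B| + b = 14 ->
    ~~ force n.-2.+1 (do_move st (a, x)).
  move=> st1_full used14; rewrite used14 in n_eq.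
  rewrite (_ : n.-2.+1 = 12); last by move: n_eq; clear; lia.
  exact: (trap_endgame neq_ik st1_quiet st1_full st1_O erefl).
have cover (C : {set 'I_9}) g : C = ~: [set i; k] -> [|| g == i, g == k | g \in C].
  by move=> ->; rewrite !inE; case: (g == i); case: (g == k).
have full7 (C : {set 'I_9}) : C \subset ~: [set i; k] -> 7 <= #|C| -> C = ~: [set i; k].
  by move=> sub_C C_ge7; apply/eqP; rewrite eqEcard sub_C card_TC.
have notT y : y != i -> y != k -> y \notin [set i; k].
  by rewrite !inE negb_or => -> ->.
have cardU1 (C : {set 'I_9}) y : y \notin C -> #|y |: C| = #|C|.+1.
  by move=> Cy; rewrite cardsU1 Cy.
have subU1 y : y \notin [set i; k] -> y |: (A :|: B) \subset ~: [set i; k].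
  by move=> Ty; rewrite subUset sub1set inE Ty (trap_sub st_trap).
have swap p q r : [|| p, q | r] = [|| q, p | r] by rewrite orbCA.
have /set2P[eq_a | eq_a] := Ta; subst a.
  have /and3P[neq_xi Ax xkb] : [&& x != i, x \notin A & ~~ ((x == k) && b)].
    by move: ax_free; rewrite free_i !negb_or.
  rewrite (negPf neq_ik) add0n in card_AB.
  have [eq_x | neq_xk] := eqVneq x k.
    subst x; rewrite eqxx /= in xkb; have b_f : b = false by apply/negbTE.
    have ki_free : free st (k, i) by rewrite free_k (negPf neq_ik) notB // b_f andbF.
    have neq_ki2 : (k, i) != (i, k) by rewrite xpair_eqE neq_ki.
    have used p : trap_used i k A B true p =
        [|| p == (k, i), p == (i, k) | trap_used i k A B b p].
      by rewrite b_f trap_used_swap // swap.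
    have [A_full | A_neq] := eqVneq A (~: [set i; k]); last first.
      apply: (next i A B true) => //; rewrite ?(negPf A_neq) ?(negPf neq_ik) //.
        exact: trap_sub st_trap.
      by rewrite b_f addn0 addn1.
    (* As [A] lies in [B], both are full, and Olivia's answer [(k, i)] fills the trap. Xavier then
       chooses freely, with 41 - 28 - 2 = 11 plies left. *)
    have B_full : B = ~: [set i; k].
      apply: full7 => //; rewrite -card_AB.
      by have := subset_leq_card (subsetUl A B); rewrite {1}A_full card_TC.
    apply: (reply i A B true) => // [_ _ st2_trap|]; last exact: trap_sub st_trap.
    rewrite (_ : n.-2 = 11); last first.
      by move: n_eq; rewrite A_full B_full card_TC b_f; clear; lia.
    apply: (trap_endgame_Xavier neq_ik (trap_quiet st2_trap)); last by rewrite /= st_X.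
    move=> f g; rewrite (trap_free st2_trap) negbK /trap_used /= !inE.
    case/orP=> /eqP ->; rewrite ?neq_ki eqxx andbT.
      by have := cover A g A_full; do !case: (_ == _) => //=; case: (_ \in _).
    by have := cover B g B_full; do !case: (_ == _) => //=; case: (_ \in _).
  have Tx := notT x neq_xi neq_xk.
  (* A first visit sends Xavier to [k]. A second one sends him back to [i], unless his move has just
     filled [i]; then [k] is full too. *)
  have [Bx | Bx] := boolP (x \in B); last first.
    apply: (next k (x |: A) B b); rewrite ?neq_ki ?eqxx //.
    - by rewrite free_ok // inE negb_or Ax.
    - by rewrite xpair_eqE (negPf neq_xi).
    - by rewrite -setUA subU1.
    - by move=> p; have [_ ->] := trap_used_round A B b p neq_ik Tx.
    - by rewrite -setUA cardU1 ?card_AB // inE negb_or Ax.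
    by rewrite cardU1.
  have unionE : x |: A :|: B = A :|: B.
    by rewrite -setUA; apply/setUidPr; rewrite sub1set inE Bx orbT.
  have [/andP[/eqP A_full b_t] | open] := boolP ((x |: A == ~: [set i; k]) && b).
    have B_full : B = ~: [set i; k].
      apply: full7 => //; rewrite -card_AB.
      by have := subset_leq_card (subsetUl (x |: A) B); rewrite unionE A_full card_TC.
    apply: finish.
      move=> f g; rewrite free_do_move negb_and negbK !inE => /orP[]/eqP ->.
        rewrite free_i negbK b_t andbT xpair_eqE eqxx /=.
        have := cover _ g A_full; rewrite !inE.
        by do !case: (_ == _); case: (_ \in _).
      rewrite free_k negbK b_t andbT.
      by have := cover _ g B_full; do !case: (_ == _) => //=; case: (_ \in _).
    move: A_full => /(congr1 (fun C : {set _} => #|C|)); rewrite cardU1 // card_TC => -[->].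
    by rewrite B_full card_TC b_t.
  apply: (next i (x |: A) B b); rewrite ?(negPf neq_ik) ?eqxx ?unionE //.
  - by rewrite free_oi // inE negb_and Ax.
  - by rewrite xpair_eqE (negPf neq_xi).
  - exact: trap_sub st_trap.
  - by move=> p; have [_ _ _ ->] := trap_used_round A B b p neq_ik Tx.
  by rewrite cardU1.
have /and3P[neq_xk Bx xib] : [&& x != k, x \notin B & ~~ ((x == i) && b)].
  by move: ax_free; rewrite free_k !negb_or.
rewrite eqxx in card_AB.
have [eq_x | neq_xi] := eqVneq x i.
  subst x; rewrite eqxx /= in xib; have b_f : b = false by apply/negbTE.
  apply: (next k A B true); rewrite ?neq_ki ?eqxx //.
  - by rewrite free_i neq_ki notA // b_f andbF.
  - by rewrite xpair_eqE (negPf neq_ik).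
  - exact: trap_sub st_trap.
  - by move=> p; rewrite b_f trap_used_swap.
  by rewrite b_f addn0 addn1.
have Tx := notT x neq_xi neq_xk.
(* The one element of [A] outside [B] sends Xavier to [i], or ends the trap if [i] is full; any
   other outside field keeps him in [k]. *)
have [Ax | Ax] := boolP (x \in A); last first.
  have unionE : A :|: (x |: B) = x |: (A :|: B) by rewrite setUCA.
  apply: (next k A (x |: B) b); rewrite ?neq_ki ?eqxx ?unionE //.
  - by rewrite free_ok // inE negb_or Ax.
  - by rewrite xpair_eqE (negPf neq_xk).
  - by rewrite subU1.
  - by move=> p; have [->] := trap_used_round A B b p neq_ik Tx.
  - by rewrite !cardU1 ?card_AB // inE negb_or Ax.
  by rewrite cardU1 // addnS.
have unionE : A :|: (x |: B) = A :|: B.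
  by rewrite setUCA; apply/setUidPr; rewrite sub1set inE Ax.
have [/andP[/eqP A_full b_t] | open] := boolP ((A == ~: [set i; k]) && b).
  have B_full : x |: B = ~: [set i; k].
    apply: full7; first by rewrite subUset sub1set inE Tx sub_B.
    rewrite cardU1 //; have := subset_leq_card (subsetUl A B).
    by rewrite {1}A_full card_TC card_AB.
  apply: finish.
    move=> f g; rewrite free_do_move negb_and negbK !inE => /orP[]/eqP ->.
      rewrite free_i negbK b_t andbT.
      by have := cover _ g A_full; do !case: (_ == _) => //=; case: (_ \in _).
    rewrite free_k negbK b_t andbT xpair_eqE eqxx /=.
    have := cover _ g B_full; rewrite !inE.
    by do !case: (_ == _); case: (_ \in _).
  move: B_full => /(congr1 (fun C : {set _} => #|C|)); rewrite cardU1 // card_TC => -[->].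
  by rewrite A_full card_TC b_t.
apply: (next i A (x |: B) b); rewrite ?(negPf neq_ik) ?eqxx ?unionE //.
- by rewrite free_oi // inE negb_and Bx orbT.
- by rewrite xpair_eqE (negPf neq_xk).
- exact: trap_sub st_trap.
- by move=> p; have [_ _ ->] := trap_used_round A B b p neq_ik Tx.
- by rewrite cardU1.
by rewrite cardU1 // addnS.
Qed.

(** * Refutation of the other second moves *)

(** Olivia's second move sets the trap. If [k = j], she already holds [(i, k)] and adds [(k, i)].
    Otherwise she plays [(k, k)], and Xavier's own mark [(j, k)] replaces her answer to a first
    visit of [j] from [i]. *)
Lemma hold_second_move (i j k : 'I_9) :
  j != i -> k != i -> ~~ force 40 (after [:: (i, i); (i, j); (j, k)]).
Proof.
move=> neq_ji neq_ki; have neq_ik : i != k by rewrite eq_sym.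
set st := after _.
have st_free x : free st x = [&& x != (j, k), x != (i, j) & x != (i, i)].
  by rewrite /st /after /= !free_do_move andbT.
have own f : owner st f != Some Xavier.
  have init0 : xcount init f = 0 by apply: eq_card0 => g; rewrite inE.
  have c1 := xcount_do_move init (i, i) f; rewrite init0 addn0 in c1.
  have c2 := xcount_do_move (after [:: (i, i)]) (i, j) f.
  have c3 := xcount_do_move (after [:: (i, i); (i, j)]) (j, k) f.
  apply: owner_xcount.
    apply: owner_not_mover => //; apply: owner_xcount => //.
    by apply: leq_trans c1 _; case: (_ == _).
  apply: leq_trans c3 _; apply: leq_add (leq_b1 _) _.
  by apply: leq_trans c2 _; apply: leq_trans c1 _; apply: leq_b1.
have not_won p st' : (forall f, owner st' f != Some p) -> ~~ wins p st'.
  by move=> own'; apply: wins_card; rewrite eq_card0 // => f; rewrite inE (negPf (own' f)).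
have markX f g : mark st (f, g) = Some Xavier -> f \notin [set i; k] -> f = j /\ g = k.
  rewrite /st /after /=.
  case: eqP => [[-> ->] // | _]; case: eqP => // _; case: eqP => [[-> _] _|] //.
  by rewrite !inE eqxx.
apply: hold_Olivia => // [|not_over]; first exact: not_won.
have st_last : last_move st = Some (j, k) by [].
have markX' z f g : mark (do_move st (k, z)) (f, g) = Some Xavier ->
    f \notin [set i; k] -> f = j /\ g = k.
  by rewrite [mark _ _]/=; case: ifP => // _; apply: markX.
have own' z f : f \notin [set i; k] -> owner (do_move st (k, z)) f != Some Xavier.
  by move=> _; apply: owner_not_mover.
have [eq_kj | neq_kj] := eqVneq k j.
  exists (k, i).
    apply: legal_reply st_last not_over _; rewrite st_free eq_kj !xpair_eqE eqxx.
    by rewrite (negPf neq_ji) (eq_sym i) (negPf neq_ji).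
  (* The pair [(i, k)], [(k, i)] is the only unit used up, and 39 + 2 = 41. *)
  apply: (@trap_hold i k j 39 set0 set0 true _ k i) => //; last 1 first.
  - by rewrite cards0.
  - split=> [|x||f g Tf /markX'];
      [by rewrite setU0 sub0set | | exact: own' | exact].
    rewrite free_do_move st_free eq_kj; case: x => u v.
    rewrite /trap_used /= !inE !xpair_eqE andbT.
    have [->|_] := eqVneq u i; first by rewrite eq_sym (negPf neq_ji); do !case: (_ == _).
    by do !case: (_ == _).
  - by rewrite !inE eqxx.
  - by rewrite setU0 cards0 (negPf neq_ik).
  by move=> _; rewrite andbT eq_sym -card_gt0 cardsC2.
exists (k, k).
  apply: legal_reply st_last not_over _.
  by rewrite st_free !xpair_eqE (negPf neq_kj) (negPf neq_ki).
(* Now [j] in [A] is the only unit, and again 39 + 2 = 41. *)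
apply: (@trap_hold i k j 39 [set j] set0 false _ k k) => //; last 1 first.
- by rewrite cards0 cards1.
- split=> [|x||f g Tf /markX']; [| | exact: own' | exact].
    by rewrite setU0 sub1set !inE negb_or neq_ji eq_sym.
  rewrite free_do_move st_free; case: x => u v.
  rewrite /trap_used /= !inE !xpair_eqE !andbF !orbF.
  have [->|_] := eqVneq u i.
    by rewrite (negPf neq_ik) (eq_sym i) (negPf neq_ji); do !case: (_ == _).
  have [->|_] := eqVneq u k; first by rewrite (negPf neq_kj); do !case: (_ == _).
  by do !case: (_ == _).
- by rewrite !inE eqxx orbT.
- by rewrite setU0 cards0 cards1 eqxx.
by rewrite andbF.
Qed.

(** * Xavier's chase through two opposite fields *)

Definition center : 'I_9 := @Ordinal 9 4 isT.

(** [rev_ord] maps [c] to [8 - c], the reflection of the grid through its center. *)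
Lemma rev_ord_center c : c != center -> rev_ord c != center /\ rev_ord c != c.
Proof.
by case: c => [[|[|[|[|[|[|[|[|[|//]]]]]]]]] c_lt].
Qed.

Lemma rev_ord_line c :
  c != center -> has_line (fun k => [|| k == center, k == c | k == rev_ord c]).
Proof.
by case: c => [[|[|[|[|[|[|[|[|[|//]]]]]]]]] c_lt].
Qed.

(** The field [y] is the one of the six remaining fields that Xavier may lack. *)
Lemma five_fields_line c y :
  c != center ->
  has_line (fun f => (f == rev_ord c) || [&& f != center, f != c & f != y]).
Proof.
by case: c => [[|[|[|[|[|[|[|[|[|//]]]]]]]]] c_lt];
   case: y => [[|[|[|[|[|[|[|[|[|//]]]]]]]]] y_lt].
Qed.

Lemma not_game_over st f g :
  ~~ wins Xavier st -> ~~ wins Olivia st -> free st (f, g) -> ~~ game_over st.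
Proof.
move=> notX notO fg_free; rewrite /game_over (negPf notX) (negPf notO) !orFb.
by rewrite negb_forall; apply/existsP; exists f; rewrite negbK; apply/existsP; exists g.
Qed.

Definition rest (c : 'I_9) := ~: [set center; c; rev_ord c].

Lemma card_rest c : c != center -> #|rest c| = 6.
Proof.
move=> c_neq; have [d_neq dc_neq] := rev_ord_center c_neq.
have := cardsC [set center; c; rev_ord c].
rewrite -/(rest c) setUC cardsU1 cards2 !inE negb_or d_neq dc_neq.
by rewrite eq_sym c_neq card_ord => -[].
Qed.

(* Olivia is confined to the fields [c] and [d := rev_ord c]; [C] and [D] are
   the sets of fields of [rest c] indexed by her spots in [c] and in [d]. Xavier
   answers in a field [f] of [rest c] by [(f, c)] on his first visit and by the
   winning [(f, d)] on his second one. When Olivia plays [(c, d)] or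
   [(c, center)], recorded by [s] and [t], he plays [(d, c)] the first time, and
   [(d, d)], which wins [d], the second time. *)
Record chase c (C D : {set 'I_9}) (s t : bool) (a : 'I_9) st := Chase {
  chase_sub : C :|: D \subset rest c;
  chase_move : to_move st = Olivia;
  chase_last : exists m, last_move st = Some (m, a);
  chase_active : a = c \/ a = rev_ord c;
  chase_center : forall g, ~~ free st (center, g);
  chase_c : forall g, free st (c, g) =
    ~~ [|| g == c, g \in C, (g == rev_ord c) && s | (g == center) && t];
  chase_d : forall g, free st (rev_ord c, g) =
    ~~ [|| g == center, g \in D, (g == c) && (s || t) |
           (g == rev_ord c) && (s && t)];
  chase_rest : forall f g, f \in rest c -> mark st (f, g) =
    if [|| g == center, (g == c) && (f \in C :|: D) |
           (g == rev_ord c) && (f \in C :&: D)]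
    then Some Xavier else None;
  chase_dX : mark st (rev_ord c, center) = Some Xavier /\
    (s || t -> mark st (rev_ord c, c) = Some Xavier);
  chase_notO : forall f, f \notin [set center; c] -> owner st f != Some Olivia;
  chase_X : forall f, f \in C :&: D -> owner st f = Some Xavier;
  chase_dwon : s && t -> owner st (rev_ord c) = Some Xavier;
  chase_open : ~~ (s && t) -> D = set0 /\ a = c;
  chase_count : #|C| + s + t + (a == c) = 1 + #|C :|: D| + (s || t) }.

(** Fields visited from both sides are Xavier's. Having five of them makes [D] nonempty, so
    [rev_ord c] is his as well. *)
Lemma chase_won c C D s t a st :
  c != center -> chase c C D s t a st -> 5 <= #|C :&: D| -> wins Xavier st.
Proof.
move=> c_neq st_chase Q_ge5.
have st_t : s && t.
  apply/negPn/negP => /(chase_open st_chase)[D0 _].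
  by rewrite D0 setI0 cards0 in Q_ge5.
have sub_Q : C :&: D \subset rest c.
  apply: subset_trans (chase_sub st_chase).
  by apply/subsetP => f; rewrite !inE => /andP[->].
have /card_le1_eqP E_le1 : #|rest c :\: (C :&: D)| <= 1.
  by rewrite cardsD (setIidPr sub_Q) card_rest // leq_subLR addn1.
(* The default [c] is harmless: the line avoids [c] anyway. *)
pose y := odflt c [pick f in rest c :\: (C :&: D)].
apply: sub_has_line (five_fields_line y c_neq) => f.
case/predU1P => [-> | /and3P[f4 fc fy]]; first by rewrite (chase_dwon st_chase).
have [-> | fd] := eqVneq f (rev_ord c); first by rewrite (chase_dwon st_chase).
have Rf : f \in rest c by rewrite !inE !negb_or f4 fc fd.
rewrite (chase_X st_chase) //; apply: contraNT fy => notQ.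
have Ef : f \in rest c :\: (C :&: D) by rewrite in_setD notQ Rf.
rewrite /y; case: pickP => [g Eg | /(_ f)]; last by rewrite Ef.
by rewrite (E_le1 _ _ Ef Eg).
Qed.

Lemma owner_kept st m f p :
  owner st f = Some p -> owner (do_move st m) f = Some p.
Proof.
move=> own_f; rewrite /=; case: ifP => // /andP[/andP[/eqP own _] /eqP eq_f].
by rewrite -eq_f own_f in own.
Qed.

(* The clauses of [chase] that are not premises here hold after any reply. *)
Lemma chase_reply c C D s t a x y z C' D' s' t' st
    (st' := do_move (do_move st (a, x)) (y, z)) :
  c != center -> chase c C D s t a st -> free st (a, x) ->
  (y, z) != (rev_ord c, center) -> C' :|: D' \subset rest c ->
  z = c \/ z = rev_ord c ->
  (forall g, free st' (c, g) =
    ~~ [|| g == c, g \in C', (g == rev_ord c) && s' | (g == center) && t']) ->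
  (forall g, free st' (rev_ord c, g) =
    ~~ [|| g == center, g \in D', (g == c) && (s' || t') |
           (g == rev_ord c) && (s' && t')]) ->
  (forall f g, f \in rest c -> mark st' (f, g) =
    if [|| g == center, (g == c) && (f \in C' :|: D') |
           (g == rev_ord c) && (f \in C' :&: D')]
    then Some Xavier else None) ->
  (s' || t' -> mark st' (rev_ord c, c) = Some Xavier) ->
  (forall f, f \in C' :&: D' -> f \notin C :&: D -> owner st' f = Some Xavier) ->
  (s' && t' -> ~~ (s && t) -> owner st' (rev_ord c) = Some Xavier) ->
  (~~ (s' && t') -> D' = set0 /\ z = c) ->
  #|C'| + s' + t' + (z == c) = 1 + #|C' :|: D'| + (s' || t') ->
  chase c C' D' s' t' z st' /\ ~~ wins Olivia (do_move st (a, x)).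
Proof.
move=> c_neq st_chase ax_free neq_yz sub' active'.
move=> free_c free_d mark_rest mark_dc won_rest won_d open' count'.
have [d_neq dc_neq] := rev_ord_center c_neq.
have st_O := chase_move st_chase.
(* If Olivia moves in [rev_ord c], that field is already Xavier's, so she can gain at most [c]. *)
have notO f : f \notin [set center; c] -> owner (do_move st (a, x)) f != Some Olivia.
  move=> Tf; have [eq_a | neq_a] := eqVneq f a; last first.
    by rewrite owner_other // (chase_notO st_chase).
  have eq_d : a = rev_ord c.
    case: (chase_active st_chase) => // eq_c.
    by rewrite eq_a eq_c !inE eqxx orbT in Tf.
  rewrite eq_a eq_d (owner_kept _ (p := Xavier)) // (chase_dwon st_chase) //.
  apply/negPn/negP => /(chase_open st_chase)[_ eq_c].
  by rewrite -eq_d eq_c eqxx in dc_neq.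
split; last first.
  by apply: not_wins_out notO; rewrite cards2; case: (_ != _).
split=> //.
- by rewrite /st' /= st_O.
- by exists y.
- by move=> g; rewrite /st' !free_do_move (negPf (chase_center st_chase g)) !andbF.
- split=> //; rewrite /st' [mark _ _]/= eq_sym (negPf neq_yz).
  have [dX _] := chase_dX st_chase; rewrite dX ifN //.
  by apply: contraTN ax_free => /eqP <-; rewrite /free dX.
- move=> f Tf; apply: owner_not_mover (notO f Tf).
  by rewrite /= st_O.
- move=> f Qf; have [Qf' | /won_rest->//] := boolP (f \in C :&: D).
  by rewrite /st' !(owner_kept _ (p := Xavier)) ?(chase_X st_chase).
move=> st_t; have [st_t' | /won_d->//] := boolP (s && t).
by rewrite /st' !(owner_kept _ (p := Xavier)) ?(chase_dwon st_chase).
Qed.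

Lemma owner_line st m :
  owner st m.1 != Some (~~ to_move st) ->
  has_line (fun k => mark (do_move st m) (m.1, k) == Some (to_move st)) ->
  owner (do_move st m) m.1 = Some (to_move st).
Proof.
move=> own ln; rewrite /=; rewrite /= in ln; rewrite ln eqxx !andbT.
by case: (owner st m.1) own => [p|] //=; case: p; case: (to_move st).
Qed.

(** Each round uses up one unit of [#|C| + #|D| + s + t]. When the fifth field is visited twice, the
    total is at most 6 + 5 + 2 = 13, whence 26 plies. *)
Lemma chase_force c n : forall C D s t a st,
  c != center -> chase c C D s t a st ->
  n + (#|C| + #|D| + s + t).*2 = 26 -> force n st.
Proof.
elim/ltn_ind: n => n IHn C D s t a st c_neq st_chase n_eq.
have [won | not_won] := boolP (wins Xavier st); first exact: force_wins.
have Q_le4 : #|C :&: D| <= 4.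
  by rewrite leqNgt; apply: contra not_won; apply: chase_won st_chase.
have U_le6 : #|C :|: D| <= 6.
  by have := subset_leq_card (chase_sub st_chase); rewrite card_rest.
have UI := cardsUI C D.
have count := chase_count st_chase.
have /subUsetP[sub_C sub_D] := chase_sub st_chase.
have [d_neq dc_neq] := rev_ord_center c_neq.
have eqs : ((c == center) = false) * ((center == c) = false) *
    ((rev_ord c == center) = false) * ((center == rev_ord c) = false) *
    ((rev_ord c == c) = false) * ((c == rev_ord c) = false).
  rewrite !(eq_sym center) (eq_sym c (rev_ord c)).
  by rewrite (negPf c_neq) (negPf d_neq) (negPf dc_neq).
(* Without a win the total is at most 6 + 4 + 2 = 12, which leaves a full round. *)
have n_gt : 1 < n.
  move: n_eq; rewrite -UI; move: Q_le4 U_le6; clear.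
  by move: #|_ :|: _| #|_ :&: _| => u q; case: s; case: t => /=; lia.
have restP f : f \in rest c ->
    [/\ (f == center) = false, (f == c) = false & (f == rev_ord c) = false].
  by rewrite !inE !negb_or -andbA => /and3P[/negPf -> /negPf -> /negPf ->].
(* Once [s] and [t] hold, [chase_count] says that [D] lies in [C] when Olivia is in [rev_ord c], and
   has one element outside [C] when she is in [c]. This bounds the spots used in the active
   field. *)
have [x0 ax0_free] : exists x, free st (a, x).
  have pick_rest (E : {set 'I_9}) : #|E| < 6 -> exists2 f, f \in rest c & f \notin E.
    by move=> E_lt; apply: ex_setD; rewrite card_rest.
  have [eq_a | eq_a] := chase_active st_chase; rewrite eq_a.
    have [C_ge6 | /pick_rest[f /restP[f4 fc fd] Cf]] := leqP 6 #|C|; last first.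
      by exists f; rewrite (chase_c st_chase) f4 fc fd (negPf Cf).
    have notC g : g \notin rest c -> g \in C = false.
      by move=> Rg; apply/negbTE; apply: contra Rg; apply: (subsetP sub_C).
    have /orP[s0 | t0] : ~~ s || ~~ t.
      move: count U_le6 C_ge6; rewrite eq_a eqxx; clear.
      by move: #|_ :|: _| #|C| => u x; case: s; case: t => /=; lia.
    - exists (rev_ord c); rewrite (chase_c st_chase) (negPf s0) andbF !eqs notC //.
      by rewrite !inE eqxx !orbT.
    exists center; rewrite (chase_c st_chase) (negPf t0) andbF !eqs notC //.
    by rewrite !inE eqxx.
  have [|f /restP[f4 fc fd] Df] := pick_rest D.
    have /andP[s1 t1] : s && t.
      apply/negPn/negP => /(chase_open st_chase)[_ eq_c].
      by rewrite -eq_a eq_c eqxx in dc_neq.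
    move: count UI Q_le4; rewrite eq_a (negPf dc_neq) s1 t1; clear.
    by move: #|_ :|: _| #|_ :&: _| #|C| #|D| => u q x y /=; lia.
  by exists f; rewrite (chase_d st_chase) f4 fc fd (negPf Df).
have st_O := chase_move st_chase.
have card_T : #|[set center; c]| <= 2 by rewrite cards2; case: (_ != _).
have not_over := not_game_over not_won (not_wins_out card_T (chase_notO st_chase)) ax0_free.
rewrite (_ : n = n.-2.+2); last by move: n_gt; clear; lia.
apply: force_Olivia => // -[a' x].
have [m0 st_last] := chase_last st_chase.
move=> /(legal_active st_last ax0_free)[]; rewrite [fst _]/= => eq_a' ax_free; subst a'.
clear x0 ax0_free not_over.
have [won1 | not_won1] := boolP (wins Xavier (do_move st (a, x))); first exact: force_wins.
(* If Olivia points to the full center field, Xavier may choose [y]. *)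
have play y z C' D' s' t' : free st (y, z) -> (y, z) != (a, x) ->
    x = y \/ x = center ->
    chase c C' D' s' t' z (do_move (do_move st (a, x)) (y, z)) /\
      ~~ wins Olivia (do_move st (a, x)) ->
    #|C'| + #|D'| + s' + t' = (#|C| + #|D| + s + t).+1 ->
    force n.-2.+1 (do_move st (a, x)).
  move=> yz_free neq_yz x_y [st_chase' not_won1O] card'.
  have st1_last : last_move (do_move st (a, x)) = Some (a, x) by [].
  have yz_free1 : free (do_move st (a, x)) (y, z) by rewrite free_do_move neq_yz.
  have not_over1 := not_game_over not_won1 not_won1O yz_free1.
  apply: (@force_Xavier _ _ (y, z)); first by rewrite /= st_O.
    case: x_y => eq_x; first by subst y; apply: legal_reply st1_last not_over1 yz_free1.
    apply: legal_anywhere st1_last _ not_over1 yz_free1 => g.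
    by rewrite free_do_move negb_and eq_x (chase_center st_chase) orbT.
  apply: (IHn _ _ _ _ _ _ _ _ c_neq st_chase'); first by move: n_gt; clear; lia.
  by move: n_gt n_eq; rewrite card'; move: (_ + t); clear; lia.
have owner_rest f : f \in rest c -> owner (do_move st (a, x)) f != Some Olivia.
  move=> /restP[f4 fc fd]; rewrite owner_other ?(chase_notO st_chase) //=.
    by rewrite !inE f4 fc.
  by case: (chase_active st_chase) => ->; rewrite ?fc ?fd.
have line_won f z : owner (do_move st (a, x)) f != Some Olivia ->
    (forall g, [|| g == center, g == c | g == rev_ord c] ->
      mark (do_move (do_move st (a, x)) (f, z)) (f, g) = Some Xavier) ->
    owner (do_move (do_move st (a, x)) (f, z)) f = Some Xavier.
  have st1_X : to_move (do_move st (a, x)) = Xavier by rewrite /= st_O.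
  move: (do_move st (a, x)) st1_X => st1 st1_X own marks.
  have := @owner_line st1 (f, z); rewrite st1_X; apply=> //.
  by apply: sub_has_line (rev_ord_line c_neq) => g /marks ->.
have [dX dcX] := chase_dX st_chase.
(* Visits from [c] and from [rev_ord c] are treated together. On the second one, Xavier's marks at
   [center], [c] and [rev_ord c] form a line of the field [x]. *)
have visit C' D' (second := x \in C :|: D) : x \in rest c -> x \notin C :&: D ->
    C' :|: D' = x |: (C :|: D) ->
    C' :&: D' = (if second then x |: (C :&: D) else C :&: D) ->
    (forall g, free st (c, g) && ((c, g) != (a, x)) =
      ~~ [|| g == c, g \in C', (g == rev_ord c) && s | (g == center) && t]) ->
    (forall g, free st (rev_ord c, g) && ((rev_ord c, g) != (a, x)) =
      ~~ [|| g == center, g \in D', (g == c) && (s || t) |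
           (g == rev_ord c) && (s && t)]) ->
    (~~ (s && t) -> D' = set0 /\ ~~ second) ->
    #|C'| + #|D'| = (#|C| + #|D|).+1 ->
    #|C'| + s + t + ~~ second = 1 + #|C' :|: D'| + (s || t) ->
    force n.-2.+1 (do_move st (a, x)).
  move=> Rx notI cupE capE free_c free_d open' card' count'.
  have [x4 xc xd] := restP _ Rx.
  have cx : (c == x) = false by rewrite eq_sym.
  have dx : (rev_ord c == x) = false by rewrite eq_sym.
  pose z := if second then rev_ord c else c.
  have xa : (x == a) = false by case: (chase_active st_chase) => ->.
  have xz_free : free st (x, z).
    rewrite /free (chase_rest st_chase _ Rx) (negPf notI) /z -/second.
    by case: (second); rewrite !eqs ?andbF.
  apply: (play x z C' D' s t) => //; first by rewrite xpair_eqE xa.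
  - by left.
  - apply: (chase_reply c_neq st_chase ax_free).
    + by rewrite xpair_eqE xd.
    + by rewrite cupE subUset sub1set Rx (chase_sub st_chase).
    + by rewrite /z; case: (second); [right | left].
    + by move=> g; rewrite !free_do_move xpair_eqE cx /= andbC free_c.
    + by move=> g; rewrite !free_do_move xpair_eqE dx /= andbC free_d.
    + move=> f g Rf; have [f4 fc fd] := restP f Rf.
      have fa : (f == a) = false by case: (chase_active st_chase) => ->.
      rewrite /= st_O !xpair_eqE fa /= (chase_rest st_chase _ Rf) cupE capE.
      have [-> | neq_x] := eqVneq f x; last first.
        by rewrite /= !inE (negPf neq_x) /=; case: (second); rewrite !inE ?(negPf neq_x).
      rewrite /= setU11 andbT (negPf notI) andbF orbF -/second /z.
      case: (second); rewrite ?setU11 ?(negPf notI) ?andbT ?andbF ?orbF.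
        by do !case: (_ == _).
      by do !case: (_ == _).
    + by move=> /dcX dc; rewrite /= !xpair_eqE dx cx andbF.
    + move=> f; rewrite capE; case: ifP => [second_x | _]; last by move=> ->.
      rewrite in_setU1 => /predU1P[-> _ | -> //].
      apply: line_won => [|g g_line]; first exact: owner_rest.
      rewrite /= st_O !xpair_eqE eqxx xa /= (chase_rest st_chase _ Rx).
      rewrite /z -/second second_x andbT.
      by move: g_line; do !case: (_ == _).
    + by move=> ->.
    + by move=> /open'[-> second_f]; rewrite /z (negPf second_f).
    by rewrite -count' /z; case: (second); rewrite ?eqxx // (negPf dc_neq).
  by rewrite card' !addSn.
have capU1 (E F : {set 'I_9}) : x \notin E -> (x |: E) :&: F =
    if x \in E :|: F then x |: (E :&: F) else E :&: F.
  move=> /negPf Ex; case: ifP; rewrite !inE Ex /= => Fx; apply/setP => f.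
    by rewrite !inE; have [-> | //] := eqVneq f x; rewrite Fx.
  by rewrite !inE; have [-> | //] := eqVneq f x; rewrite Ex Fx.
have cardU1 (E : {set 'I_9}) : x \notin E -> #|x |: E| = #|E|.+1.
  by move=> Ex; rewrite cardsU1 Ex.
have cardU : #|x |: (C :|: D)| = ~~ (x \in C :|: D) + #|C :|: D| by rewrite cardsU1.
have [eq_a | eq_a] := chase_active st_chase; last first.
  have /andP[s_t t_t] : s && t.
    apply/negPn/negP => /(chase_open st_chase)[_ eq_c].
    by rewrite -eq_a eq_c eqxx in dc_neq.
  have /and4P[x4 Dx xc xd] : [&& x != center, x \notin D, x != c & x != rev_ord c].
    by move: ax_free; rewrite eq_a (chase_d st_chase) s_t t_t !andbT /= !negb_or.
  apply: (visit C (x |: D)) => [||||g|g|||].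
  - by rewrite !inE !negb_or x4 xc.
  - by rewrite inE negb_and Dx orbT.
  - by rewrite setUCA.
  - by rewrite setIC capU1 // setUC setIC.
  - by rewrite eq_a xpair_eqE !eqs andbT (chase_c st_chase).
  - rewrite eq_a xpair_eqE eqxx (chase_d st_chase) !inE.
    by do !case: (_ == _) => //=; do ?case: (_ \in _); case: (s); case: (t).
  - by rewrite s_t t_t.
  - by rewrite cardU1 // addnS.
  rewrite setUCA cardU; move: count; rewrite eq_a (negPf dc_neq) s_t t_t; clear.
  by move: #|C :|: D| #|C| => u v; case: (x \in _) => /=; lia.
have /and4P[xc Cx xds x4t] : [&& x != c, x \notin C, ~~ ((x == rev_ord c) && s) &
    ~~ ((x == center) && t)].
  by move: ax_free; rewrite eq_a (chase_c st_chase) !negb_or.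
have [Rx | Rx] := boolP (x \in rest c).
  apply: (visit (x |: C) D) => [||||g|g|st_f||] //.
  - by rewrite inE negb_and Cx.
  - by rewrite setUA.
  - exact: capU1.
  - rewrite eq_a xpair_eqE eqxx (chase_c st_chase) !inE.
    by do !case: (_ == _) => //=; do ?case: (_ \in _); case: (s); case: (t).
  - by rewrite eq_a xpair_eqE !eqs andbT (chase_d st_chase).
  - by have [-> _] := chase_open st_chase st_f; rewrite setU0.
  - by rewrite cardU1.
  rewrite -setUA cardU cardU1 //; move: count; rewrite eq_a eqxx; clear.
  by move: #|C :|: D| #|C| => u v; case: (x \in _) => /=; lia.
(* The first move sends Xavier to [rev_ord c] and the second lets him choose it. His two answers
   there make a line with his opening mark [(rev_ord c, center)]. *)
have x_spec : (x == rev_ord c) || (x == center).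
  by move: Rx; rewrite !inE negbK (negPf xc) orbF orbC.
pose s' := s || (x == rev_ord c); pose t' := t || (x == center).
pose z := if s || t then rev_ord c else c.
have [st_f s't' s_t' card_st] : [/\ ~~ (s && t), s' || t', s' && t' = s || t &
    s' + t' = (s + t).+1].
  move: x_spec xds x4t; rewrite /s' /t'; have [-> | _] := eqVneq x (rev_ord c).
    by rewrite !eqs; case: (s); case: (t).
  by move=> /= ->; case: (s); case: (t).
have [D0 _] := chase_open st_chase st_f.
have dz_free : free st (rev_ord c, z).
  rewrite (chase_d st_chase) D0 in_set0 (negPf st_f) andbF orbF /z.
  by case: (s || t); rewrite !eqs ?andbF.
have neq_dz_cx g : (rev_ord c, g) == (c, x) = false by rewrite xpair_eqE !eqs.
apply: (play (rev_ord c) z C D s' t') => //.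
- by rewrite eq_a neq_dz_cx.
- by case/orP: x_spec => /eqP ->; [left | right].
- apply: (chase_reply c_neq st_chase ax_free).
  + by rewrite xpair_eqE eqxx /z; case: (s || t); rewrite !eqs.
  + exact: chase_sub st_chase.
  + by rewrite /z; case: (s || t); [right | left].
  + move=> g; rewrite !free_do_move (chase_c st_chase) eq_a !xpair_eqE !eqs eqxx /=.
    move: x_spec; rewrite /s' /t'; have [-> _ | _ /= /eqP ->] := eqVneq x (rev_ord c).
      rewrite !eqs orbT orbF andbT.
      by do !case: (_ == _) => //=; do ?case: (_ \in _); case: (s); case: (t).
    rewrite eqxx orbT orbF andbT.
    by do !case: (_ == _) => //=; do ?case: (_ \in _); case: (s); case: (t).
  + move=> g; rewrite !free_do_move (chase_d st_chase) eq_a neq_dz_cx xpair_eqE eqxx /=.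
    rewrite s't' s_t' D0 in_set0 (negPf st_f) /z.
    case: (s || t) => /=; rewrite !andbF !orbF ?andbT.
      by do !case: (_ == _).
    by do !case: (_ == _).
  + move=> f g Rf; have [f4 fc fd] := restP f Rf.
    by rewrite /= !xpair_eqE eq_a fc fd /= (chase_rest st_chase).
  + move=> _; rewrite /= st_O eq_a neq_dz_cx xpair_eqE eqxx /= /z.
    by have [st_or | _] := boolP (s || t); rewrite ?eqs ?eqxx // dcX.
  + by move=> f ->.
  + rewrite s_t' => st_or _; apply: line_won.
      by rewrite eq_a owner_other ?(chase_notO st_chase) ?inE ?eqs.
    move=> g g_line; rewrite /= st_O eq_a neq_dz_cx xpair_eqE eqxx /= /z st_or.
    case/or3P: g_line => /eqP ->; rewrite ?eqs ?eqxx //; exact: dcX.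
  + by rewrite s_t' /z => /negPf ->.
  rewrite -[_ + s' + t']addnA card_st addnS addnA s't' /z.
  move: count; rewrite eq_a eqxx; move: (_ + t) #|_ :|: _| => u v.
  by case: (s || t); rewrite ?eqxx ?(negPf dc_neq); clear; lia.
by rewrite -addnA card_st addnS addnA.
Qed.

(** * The opening in the center field *)

(** [J] collects the [f] for which Olivia has played [(center, f)] and Xavier has answered
    [(f, center)]. *)
Record opening (J : {set 'I_9}) st := Opening {
  opening_move : to_move st = Olivia;
  opening_last : exists m, last_move st = Some (m, center);
  opening_center : forall g, free st (center, g) = (g != center) && (g \notin J);
  opening_mark : forall f g, f != center -> mark st (f, g) =
    if (g == center) && (f \in J) then Some Xavier else None;
  opening_notO : forall f, f != center -> owner st f != Some Olivia }.

(** The last answer is [(c, c)], since [(c, center)] would point to a full field and leave Olivia a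
    free choice. *)
Lemma opening_chase c J st (st' := do_move (do_move st (center, c)) (c, c)) :
  opening J st -> c != center -> c \notin J -> c |: J = ~: [set center] ->
  chase c set0 set0 false false c st'.
Proof.
move=> st_open c_neq Jc J_full; have [d_neq dc_neq] := rev_ord_center c_neq.
have st_O := opening_move st_open.
have J_in f : f != center -> f != c -> f \in J.
  move=> f4 fc; have : f \in c |: J by rewrite J_full !inE.
  by rewrite in_setU1 (negPf fc).
have mark' f g : f != center -> f != c -> mark st' (f, g) =
    if g == center then Some Xavier else None.
  move=> f4 fc; rewrite /= !xpair_eqE (negPf f4) (negPf fc) /=.
  by rewrite (opening_mark st_open) // J_in // andbT.
split.
- by rewrite setU0 sub0set.
- by rewrite /= st_O.
- by exists c.
- by left.
- move=> g; rewrite !free_do_move (opening_center st_open) !xpair_eqE eqxx /=.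
  have [-> | g4] := eqVneq g center; first by rewrite !andbF.
  have [-> | gc] := eqVneq g c; first by rewrite !andbF.
  by rewrite J_in // !andbF.
- move=> g; rewrite !free_do_move /free (opening_mark st_open) // (negPf Jc).
  by rewrite andbF !xpair_eqE eqxx (negPf c_neq) in_set0 !andbF !andbT !orbF.
- move=> g; rewrite /free mark' // in_set0 !andbF !orbF.
  by case: (g == center).
- move=> f g; rewrite !inE !negb_or -andbA => /and3P[f4 fc fd].
  by rewrite mark' // !andbF !orbF.
- by rewrite mark' // eqxx.
- move=> f; rewrite !inE negb_or => /andP[f4 fc].
  by rewrite !owner_other // (opening_notO st_open).
- by move=> f; rewrite inE in_set0.
- by [].
- by [].
by rewrite setU0 cards0 eqxx.
Qed.

(** Eight rounds exhaust the center field, so 42 - 16 = 26 plies are left for the chase. *)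
Lemma opening_force n : forall J st,
  opening J st -> J \proper ~: [set center] -> n + #|J|.*2 = 42 -> force n st.
Proof.
elim/ltn_ind: n => n IHn J st st_open J_proper n_eq.
have [won | not_won] := boolP (wins Xavier st); first exact: force_wins.
have st_O := opening_move st_open; have [m0 st_last] := opening_last st_open.
have [J_sub [g Tg Jg]] := properP J_proper.
have g_free : free st (center, g).
  by rewrite (opening_center st_open) Jg andbT; move: Tg; rewrite !inE.
have not_winO st' : (forall f, f != center -> owner st' f != Some Olivia) ->
    ~~ wins Olivia st'.
  move=> own; apply: (@not_wins_out [set center]); first by rewrite cards1.
  by move=> f; rewrite inE; apply: own.
have not_over := not_game_over not_won (not_winO _ (opening_notO st_open)) g_free.
have n_gt : 1 < n.
  have := proper_card J_proper; rewrite cardsC1 card_ord => J_lt.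
  by move: J_lt n_eq; move: #|J| => u; clear; lia.
rewrite (_ : n = n.-2.+2); last by move: n_gt; clear; lia.
apply: force_Olivia => // -[a x].
move=> /(legal_active st_last g_free)[]; rewrite [fst _]/= => eq_a; subst a.
rewrite (opening_center st_open) => /andP[x4 Jx].
set st1 := do_move st (center, x).
have [won1 | not_won1] := boolP (wins Xavier st1); first exact: force_wins.
have not_won1O : ~~ wins Olivia st1.
  by apply: not_winO => f f4; rewrite owner_other // (opening_notO st_open).
have x_free z : free st1 (x, z).
  rewrite free_do_move xpair_eqE (negPf x4) /= /free (opening_mark st_open) //.
  by rewrite (negPf Jx) andbF.
have st1_last : last_move st1 = Some (center, x) by [].
have st1_X : to_move st1 = Xavier by rewrite /= st_O.
have x_legal z : legal st1 (x, z).
  by apply: legal_reply st1_last _ _ => //; apply: not_game_over (x_free z).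
have cardU1 : #|x |: J| = #|J|.+1 by rewrite cardsU1 Jx.
have subU1 : x |: J \subset ~: [set center] by rewrite subUset sub1set !inE x4.
have [J_full | J_open] := eqVneq (x |: J) (~: [set center]).
  apply: force_Xavier (x_legal x) _ => //.
  apply: (chase_force x4 (opening_chase st_open x4 Jx J_full)).
  rewrite cards0; have : #|J|.+1 = 8 by rewrite -cardU1 J_full cardsC1 card_ord.
  by move: n_eq; move: #|J| => u; clear; lia.
apply: force_Xavier (x_legal center) _ => //.
apply: (IHn _ _ (x |: J)); first by move: n_gt; clear; lia.
- split=> [||f|f f'|f f4].
  + by rewrite /= st_O.
  + by exists x.
  + rewrite !free_do_move (opening_center st_open) !xpair_eqE eqxx in_setU1 negb_or.
    by rewrite eq_sym (negPf x4) /= andbCA.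
  + move=> f4; rewrite /= st_O !xpair_eqE (negPf f4) /= in_setU1 (opening_mark st_open) //.
    by have [-> | _] := eqVneq f x; case: (f' == center); rewrite // (negPf Jx).
  apply: owner_not_mover; first by rewrite st1_X.
  by rewrite owner_other // (opening_notO st_open).
- by rewrite properEneq J_open.
by rewrite cardU1; move: n_gt n_eq; move: #|J| => u; clear; lia.
Qed.

(** * The bound of 43 plies and the forced second move *)

Lemma init_not_over : ~~ game_over init.
Proof. by apply: (@not_game_over init center center); rewrite // /wins /has_line. Qed.

Lemma force_init : force 43 init.
Proof.
have cc_legal : legal init (center, center).
  rewrite /legal init_not_over /can_be_active !andbT /=.
  by apply/existsP; exists center.
apply: force_Xavier cc_legal _ => //; apply: (@opening_force _ set0).
- split=> [||g|f g f4|f f4] //.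
  + by exists center.
  + by rewrite free_do_move xpair_eqE eqxx in_set0 !andbT.
  by rewrite /= xpair_eqE (negPf f4) in_set0 andbF.
- rewrite proper0; apply/set0Pn; exists ord0; by rewrite !inE.
by rewrite cards0.
Qed.

Theorem lemma7 (s : strategy) (i j : 'I_9) :
  optimal s ->
  s [::] = (i, i) ->
  legal (after [:: (i, i)]) (i, j) ->
  s [:: (i, i); (i, j)] = (j, i).
Proof.
move=> [s_win s_min] s_i ij_legal.
have s_len : strategy_length s <= 43.
  have [s' s'_win] := force_strategy force_init; apply: leq_trans.
  exact: s_min.
have [s_strat s_wins] := s_win.
have neq_ji : j != i.
  by have /and3P[_ _] := ij_legal; rewrite free_do_move xpair_eqE eqxx => /andP[].
set h := [:: (i, i); (i, j)].
have h_play : is_play h.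
  rewrite (_ : h = rcons [:: (i, i)] (i, j)) // is_play_rcons ij_legal andbT.
  rewrite (_ : [:: (i, i)] = rcons [::] (i, i)) // is_play_rcons -s_i.
  by apply: s_strat => //; apply: init_not_over.
have h_cons : consistent s h.
  rewrite (_ : h = rcons (rcons [::] (i, i)) (i, j)) // !consistent_rcons s_i eqxx.
  by rewrite !orbT !andbT; apply/forallP => -[].
(* Otherwise Xavier would have won with a single mark. *)
have h_not_over : ~~ game_over (after h).
  apply/negP => h_over; have := s_wins h; rewrite /complete_play h_play h_over.
  move=> /(_ isT h_cons); apply/negP; apply: wins_card; rewrite eq_card0 // => f.
  rewrite inE; apply/negbTE/owner_not_mover => //; apply: owner_xcount => //.
  apply: leq_trans (xcount_do_move _ _ _) _.
  rewrite (_ : xcount init f = 0); last by apply: eq_card0 => g; rewrite inE.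
  by case: (_ && _).
have m_legal : legal (after h) (s h) by apply: s_strat.
have h_last : last_move (after h) = Some (i, j) by [].
have ji_free : free (after h) (j, i).
  by rewrite /after /= !free_do_move !xpair_eqE (negPf neq_ji).
have [m1 _] := legal_active h_last ji_free m_legal.
case s_h : (s h) m1 m_legal => [j' k] /= eq_j m_legal; subst j'; congr pair.
apply/eqP; apply: contraT => neq_ki.
(* A strategy of length at most 43 would force a win within 40 plies after these three moves. *)
have := hold_second_move neq_ji neq_ki.
rewrite (_ : [:: _; _; _] = rcons h (j, k)) // => /negP[].
apply: (@force_consistent s 43 (rcons h (j, k))) => //; first by rewrite is_play_rcons h_play.
by rewrite consistent_rcons h_cons s_h eqxx.
Qed.
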